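(* Let $0\le h\le n$. (1) If $h+1\le b\le n$ and $b+c=n$, then $D_{n,h}(0,b,c)=\dfrac{\prod_{l=h+1}^{b}(1-(-q)^l)}{1-(-q)^{b-h}}$. (2) If $h-1\le b\le n$ and $b+c=n-1$, then $D_{n,h}(1,b,c)=1$ if $b\in\{h-1,h\}$, and $D_{n,h}(1,b,c)=\prod_{l=h+1}^{b}(1-(-q)^l)$ if $b\ge h+1$.
   Context: $q$ is a power of an odd prime; $b,c\ge0$ are integers. Put $P(k)=\prod_{l=1}^{k}(1-(-q)^{-l})$ (empty products $=1$, empty sums $=0$). For nonnegative integers $a,b,c$ and integer $j$: if $a+b>0$, $\mathcal C_j(a,b,c)=(-1)^{j+1}\prod_{i=1}^{a+b-1}(1-(-q)^i)$; and $\mathcal C_j(0,0,c)=\sum_{l=1}^{c}\frac1{(-q)^l-1}$. Let $M_{n,h}(a,b,c,i,s)=(-q)^{n(h-i)+\frac{(i-s)(2n-i+s+1)}{2}-h^2+s(2n-2c-s)}(-1)^{i+h}\frac{P(n-i)}{P(n-h)P(h)}\cdot\frac{\prod_{l=s+1}^{h}(1-(-q)^{-l})}{P(h-i)P(i-s)}\cdot\frac{P(c)P(b)}{P(c-i+s)P(b-s)}\cdot\mathcal C_{h+1-s}(a,b-s,c+s-i)$. For nonnegative $a,b,c$ with $a+b+c=n$ and $(a,b,c)\ne(0,t,n-t)$ for $t\le h-1$, $D_{n,h}(a,b,c)=\sum_{0\le s\le\min(h,b)}\sum_{s\le i\le\min(s+c,h)}M_{n,h}(a,b,c,i,s)$.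 *)

(* Defs.v *)
From mathcomp Require Import all_boot all_order all_algebra.

Set Implicit Arguments.
Unset Strict Implicit.
Unset Printing Implicit Defensive.

Import Order.TTheory GRing.Theory Num.Theory.
Local Open Scope ring_scope.

Definition odd_prime_power (q : nat) : Prop :=
  exists p k : nat, [/\ prime p, odd p, (0 < k)%N & q = (p ^ k)%N].

Definition mq (q : nat) : rat := - q%:R.

Definition Pq (q k : nat) : rat := \prod_(1 <= l < k.+1) (1 - mq q ^- l).

Definition Cq (q : nat) (j : int) (a b c : nat) : rat :=
  if (0 < a + b)%N then (-1) ^ (j + 1) * \prod_(1 <= i < a + b) (1 - mq q ^+ i)
  else \sum_(1 <= l < c.+1) (mq q ^+ l - 1)^-1.

(* Exponent of -q in [Mq], computed in [int].  The division by 2 is exact: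
   i - s and 2n + 1 - (i - s) have opposite parities. *)
Definition Mexp (n h c i s : nat) : int :=
  n%:Z * (h%:Z - i%:Z)
  + ((i%:Z - s%:Z) * (2 * n%:Z - i%:Z + s%:Z + 1) %/ 2)%Z
  - h%:Z ^+ 2
  + s%:Z * (2 * n%:Z - 2 * c%:Z - s%:Z).

(* For s <= min(h, b), s <= i <= min(s + c, h) and h <= n, the only arguments
   at which [Mq] is used, none of the natural-number subtractions truncates. *)
Definition Mq (q n h a b c i s : nat) : rat :=
  mq q ^ Mexp n h c i s * (-1) ^+ (i + h)
  * (Pq q (n - i) / (Pq q (n - h) * Pq q h))
  * ((\prod_(s.+1 <= l < h.+1) (1 - mq q ^- l))
     / (Pq q (h - i) * Pq q (i - s)))
  * (Pq q c * Pq q b / (Pq q (c + s - i) * Pq q (b - s)))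
  * Cq q (h%:Z + 1 - s%:Z) a (b - s) (c + s - i).

(* Meaningful only for a + b + c = n and (a, b, c) <> (0, t, n - t) for all
   t <= h - 1. *)
Definition Dq (q n h a b c : nat) : rat :=
  \sum_(0 <= s < (minn h b).+1)
    \sum_(s <= i < (minn (s + c) h).+1) Mq q n h a b c i s.

(* Main.v *)
Require Import Defs.
From mathcomp Require Import all_boot all_order all_algebra.
From mathcomp Require Import zify ring.

(* Write x = -q, y = 1/x, m = a + b, and [n, k]_x, (x)_k for Gaussian binomials
   and q-Pochhammer symbols.  Setting i = s + k, the factors of M_{n,h} that
   depend on k are (-1)^k y^(k choose 2) [c, k]_y [n - s - k, n - h]_y, and
   q-Vandermonde sums them over k to y^(c(h-s)) [m - s, h - s]_y.  After passing
   from base y to base x, the sum over s becomes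
     sum_s [h, s]_x x^(s(e+1)) (x)_(e+h-s) = (x)_e,
   with e = m - h - 1 if a = 0 and e = m - h if a = 1.  When a = 1 and h = b + 1
   the term s = h is absent from D_{n,h}, so it is subtracted; this gives 1. *)

Import Order.TTheory GRing.Theory Num.Theory.
Local Open Scope ring_scope.

(** * Gaussian binomials and q-Pochhammer symbols *)

Definition qpoch (R : nzRingType) (x : R) (k : nat) : R :=
  \prod_(1 <= l < k.+1) (1 - x ^+ l).

(** The q-Pascal rule avoids division, so identities can be proved for every x. *)
Fixpoint gbin (R : nzRingType) (x : R) (n k : nat) : R :=
  match n, k with
  | _, 0 => 1
  | 0, _.+1 => 0
  | n'.+1, k'.+1 => gbin R x n' k' + x ^+ k'.+1 * gbin R x n' k'.+1
  end.

Arguments qpoch {R} x k.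
Arguments gbin {R} x n k.

Lemma qpoch0 (R : nzRingType) (x : R) : qpoch x 0 = 1.
Proof. by rewrite /qpoch big_geq. Qed.

Lemma qpochS (R : nzRingType) (x : R) (k : nat) :
  qpoch x k.+1 = qpoch x k * (1 - x ^+ k.+1).
Proof. by rewrite /qpoch big_nat_recr. Qed.

Lemma gbin0 (R : nzRingType) (x : R) (n : nat) : gbin x n 0 = 1.
Proof. by case: n. Qed.

Lemma gbinS (R : nzRingType) (x : R) (n k : nat) :
  gbin x n.+1 k.+1 = gbin x n k + x ^+ k.+1 * gbin x n k.+1.
Proof. by []. Qed.

Lemma gbin_small (R : nzRingType) (x : R) (n k : nat) :
  (n < k)%N -> gbin x n k = 0.
Proof.
elim: n k => [|n IHn] [|k] //= ltnk.
by rewrite !IHn ?mulr0 ?addr0 //; lia.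
Qed.

Lemma gbinn (R : nzRingType) (x : R) (n : nat) : gbin x n n = 1.
Proof. by elim: n => //= n ->; rewrite gbin_small // mulr0 addr0. Qed.

(** The two Pascal terms contribute (x)_n times 1 - x^(k+1) and x^(k+1) (1 - x^(n-k)), which add up
    to 1 - x^(n+1). *)
Lemma gbin_qpoch (R : comNzRingType) (x : R) (n k : nat) :
  (k <= n)%N -> gbin x n k * (qpoch x k * qpoch x (n - k)) = qpoch x n.
Proof.
elim: n k => [|n IHn] [|k] //=.
- by rewrite qpoch0 !mul1r.
- by rewrite qpoch0 subn0 !mul1r.
rewrite ltnS subSS leq_eqVlt => /predU1P[->|ltkn].
  by rewrite gbinn gbin_small // subnn qpoch0 mulr0 addr0 mul1r mulr1.
have IH1 := IHn k (ltnW ltkn); have IH2 := IHn k.+1 ltkn.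
have -> : (n - k = (n - k.+1).+1)%N by lia.
have {}IH1 : gbin x n k * (qpoch x k * qpoch x (n - k.+1).+1) = qpoch x n.
  by rewrite -[RHS]IH1; congr (_ * (_ * qpoch _ _)); lia.
rewrite mulrDl [X in X + _](_ : _ = qpoch x n * (1 - x ^+ k.+1)); last first.
  by rewrite -IH1 (qpochS _ x k); ring.
rewrite [X in _ + X](_ : _ = qpoch x n * (x ^+ k.+1 * (1 - x ^+ (n - k.+1).+1))).
  rewrite (qpochS _ x n) (_ : x ^+ n.+1 = x ^+ k.+1 * x ^+ (n - k.+1).+1).
    by ring.
  by rewrite -exprD; congr (_ ^+ _); lia.
by rewrite -IH2 (qpochS _ x (n - k.+1)); ring.
Qed.

Lemma qpoch_neq0 (F : fieldType) (x : F) (k : nat) :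
  (forall l, x ^+ l.+1 != 1) -> qpoch x k != 0.
Proof.
move=> x_gen; elim: k => [|k IHk]; first by rewrite qpoch0 oner_neq0.
by rewrite qpochS mulf_neq0 // subr_eq0 eq_sym.
Qed.

Lemma gbinE (F : fieldType) (x : F) (n k : nat) :
  (forall l, x ^+ l.+1 != 1) -> (k <= n)%N ->
  gbin x n k = qpoch x n / (qpoch x k * qpoch x (n - k)).
Proof.
move=> x_gen lekn; rewrite -(gbin_qpoch _ x n k lekn) mulfK //.
by rewrite mulf_neq0 // qpoch_neq0.
Qed.

Lemma gbinS_dual (R : comNzRingType) (x : R) (n k : nat) :
  gbin x n.+1 k.+1 = x ^+ (n - k) * gbin x n k + gbin x n k.+1.
Proof.
elim: n k => [|n IHn] [|k].
- by rewrite /=; ring.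
- by rewrite /=; ring.
- by rewrite gbinS {1}IHn !subn0 gbinS !gbin0 (exprS x n); ring.
rewrite gbinS {1}IHn {1}(IHn k.+1) !gbinS subSS.
(* For n <= k the subtraction [n - k.+1] truncates, but its coefficient [gbin x n k.+1] is zero. *)
case: (ltnP k n) => [ltkn|lenk]; last by rewrite (gbin_small _ x n k.+1) //; ring.
have -> : (n - k = (n - k.+1).+1)%N by lia.
by rewrite !exprS; ring.
Qed.

Lemma gbin_sym (R : comNzRingType) (x : R) (k l : nat) :
  gbin x (k + l) k = gbin x (k + l) l.
Proof.
move: {2}(k + l)%N (leqnn (k + l)) => m.
elim: m k l => [|m IHm] [|k] [|l] // lem.
- by rewrite gbin0 gbinn.
- by rewrite addn0 gbin0 gbinn.
rewrite {2}addSn gbinS_dual addnS addSn gbinS.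
have -> : ((k + l.+1 - l) = k.+1)%N by lia.
rewrite addnS addrC -addSn (IHm k.+1 l) 1?addSnnS ?(IHm k l.+1) //; lia.
Qed.

(** The dual Pascal rule in base x matches, term by term, the ordinary rule in base 1/x. *)
Lemma gbin_inv (F : fieldType) (x : F) (n k : nat) :
  x != 0 -> (k <= n)%N -> gbin x n k = x ^+ (k * (n - k)) * gbin x^-1 n k.
Proof.
move=> x_neq0; elim: n k => [|n IHn] [|k] // lekn; rewrite ?gbin0 ?mulr1 //.
rewrite gbinS_dual gbinS subSS IHn // mulrDr mulrA -exprD mulSn.
congr (_ + _).
case: (ltnP k n) => [ltkn|lenk]; last by rewrite !gbin_small ?mulr0.
rewrite IHn // mulrA; congr (_ * _).
have -> : (n - k + k * (n - k) = k.+1 * (n - k.+1) + k.+1)%N.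
  by have -> : (n - k = (n - k.+1).+1)%N by [lia]; lia.
by rewrite exprD exprVn mulfK // expf_neq0.
Qed.

(** * Summation by induction on the upper index *)

Lemma sum_gbinS (R : comNzRingType) (x : R) (n : nat) (f : nat -> R) :
  \sum_(0 <= k < n.+2) gbin x n.+1 k * f k =
  \sum_(0 <= k < n.+1) gbin x n k * (f k + x ^+ (n - k) * f k.+1).
Proof.
rewrite big_nat_recl // gbin0.
under eq_bigr do rewrite gbinS_dual mulrDl.
rewrite big_split /= addrCA.
have -> : 1 * f 0%N + \sum_(0 <= i < n.+1) gbin x n i.+1 * f i.+1 =
          \sum_(0 <= i < n.+1) gbin x n i * f i.
  rewrite [RHS]big_nat_recl // gbin0 big_nat_recr //=.
  by rewrite gbin_small // mul0r addr0.
by rewrite -big_split; apply: eq_bigr => i _ /=; ring.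
Qed.

(* A coefficient of (z; y)_c / (z; y)_(r+1) = 1 / (z y^c; y)_(r+1-c). *)
Lemma gbin_alternating_sum (R : comNzRingType) (y : R) (c r u : nat) :
  (c <= r)%N ->
  \sum_(0 <= k < c.+1)
     gbin y c k * ((-1) ^+ k * y ^+ 'C(k, 2) * gbin y (r + u - k) r) =
  y ^+ (c * u) * gbin y (r + u - c) u.
Proof.
elim: c u => [|c IHc] u ltcr.
  by rewrite big_nat1 gbin0 subn0 mul0n bin0n !mul1r gbin_sym.
rewrite sum_gbinS; under eq_bigr do rewrite mulrDr.
rewrite big_split /= IHc 1?ltnW //.
case: u => [|u].
  rewrite big_nat big1 => [|k /andP[_ lekc]].
    by rewrite !gbin0 !muln0 addr0.
  by rewrite (gbin_small _ y (r + 0 - k.+1)) ?mulr0 //; lia.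
(* Passing from k to k + 1 adds k to the binomial exponent, and y^(c-k) y^k = y^c leaves the sum;
   what remains is the sum for u - 1. *)
rewrite (eq_big_nat _ _ (F2 := fun k => - y ^+ c *
   (gbin y c k * ((-1) ^+ k * y ^+ 'C(k, 2) * gbin y (r + u - k) r)))); last first.
  move=> k /andP[_ lekc]; rewrite addnS subSS binS bin1.
  have -> : y ^+ c = y ^+ (c - k) * y ^+ k by rewrite -exprD subnK.
  by rewrite exprD (exprS (-1)); ring.
rewrite -mulr_sumr IHc 1?ltnW // addnS subSS.
have -> : ((r + u).+1 - c = (r + u - c).+1)%N by lia.
by rewrite gbinS !mulSn !mulnS !exprD; ring.
Qed.

(** The two terms given by [sum_gbinS] merge into the summand for the smaller h, since (1 -
    x^(e+h-s+1)) + x^(h-s) x^(e+1) = 1. *)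
Lemma gbin_qpoch_sum (R : comNzRingType) (x : R) (h e : nat) :
  \sum_(0 <= s < h.+1) gbin x h s * (x ^+ (s * e.+1) * qpoch x (e + h - s)) =
  qpoch x e.
Proof.
elim: h => [|h IHh]; first by rewrite big_nat1 addn0 subn0 gbin0 !mul1r.
rewrite sum_gbinS -[RHS]IHh; apply: eq_big_nat => s /andP[_ lesh].
have -> : (e + h.+1 - s = (e + h - s).+1)%N by lia.
have -> : (e + h.+1 - s.+1 = e + h - s)%N by lia.
have -> : (s.+1 * e.+1 = s * e.+1 + e.+1)%N by lia.
rewrite qpochS (_ : (e + h - s).+1 = (h - s + e.+1)%N); last by lia.
by rewrite !exprD; ring.
Qed.

(** * Quotient identities in a field *)

Lemma prod_qpoch (F : fieldType) (x : F) (m n : nat) :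
  (forall l, x ^+ l.+1 != 1) -> (m <= n)%N ->
  \prod_(m.+1 <= l < n.+1) (1 - x ^+ l) = qpoch x n / qpoch x m.
Proof.
move=> x_gen lemn; rewrite [in RHS]/qpoch (big_cat_nat (m := 1) (n := m.+1)) //=.
by rewrite mulrC mulKf // qpoch_neq0.
Qed.

(** Trinomial revision: it pulls a factor free of s out of the sum over s. *)
Lemma gbin_mul_gbin (F : fieldType) (x : F) (m h s : nat) :
  (forall l, x ^+ l.+1 != 1) -> (s <= h)%N -> (h <= m)%N ->
  gbin x (m - s) (h - s) * gbin x m s = gbin x m h * gbin x h s.
Proof.
move=> x_gen lesh lehm; have nz k := qpoch_neq0 F x k x_gen.
rewrite !gbinE //; [|lia..].
have -> : (m - s - (h - s) = m - h)%N by lia.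
by field; rewrite !nz.
Qed.

Lemma gbin_predl (F : fieldType) (x : F) (n k : nat) :
  (forall l, x ^+ l.+1 != 1) -> (k <= n)%N ->
  gbin x n k = gbin x n.+1 k * (1 - x ^+ (n.+1 - k)) / (1 - x ^+ n.+1).
Proof.
move=> x_gen lekn; have nz k := qpoch_neq0 F x k x_gen.
have nz1 l : 1 - x ^+ l.+1 != 0 by rewrite subr_eq0 eq_sym.
rewrite !gbinE // 1?leqW // subSn // !qpochS.
by field; rewrite !nz !nz1.
Qed.

(** * The summand [Mq] and its sum over i *)

Lemma double_bin2 (k : nat) : (2 * 'C(k, 2) + k = k * k)%N.
Proof. by elim: k => // k IHk; rewrite binS bin1; lia. Qed.

Lemma MexpE (n h m c k s : nat) :
  (m + c = n)%N -> (k + s <= h)%N -> (h <= m)%N ->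
  Mexp n h c (k + s) s =
  (h * (m - h) + s * (m - s) + c * (h - s))%N%:Z - ('C(k, 2))%:Z.
Proof.
move=> <- /subnKC <-; move: (h - _)%N => u /subnKC <-; move: (m - _)%N => v.
have E := double_bin2 k; rewrite /Mexp.
(* With i - s = k the numerator is k (2n - k + 1), twice n k - C(k, 2). *)
rewrite [X in (X %/ 2)%Z](_ : _ =
  ((k + s + u + v + c)%N%:Z * k%:Z - ('C(k, 2))%:Z) * 2); last by lia.
rewrite mulzK // addKn.
have -> : (k + s + u - s = k + u)%N by lia.
have -> : (k + s + u + v - s = k + u + v)%N by lia.
lia.
Qed.

Lemma Pq_qpoch (q k : nat) : Pq q k = qpoch (mq q)^-1 k.
Proof. by apply: eq_bigr => l _; rewrite exprVn. Qed.

Lemma mq_neq0 (q : nat) : odd_prime_power q -> mq q != 0.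
Proof.
case=> p [k [p_prime _ _ ->]].
by rewrite /mq oppr_eq0 pnatr_eq0 expn_eq0 eqn0Ngt prime_gt0.
Qed.

(** The absolute value q^(l+1) exceeds 1; hence no Pochhammer symbol in -q vanishes. *)
Lemma mq_exp_neq1 (q l : nat) : odd_prime_power q -> mq q ^+ l.+1 != 1.
Proof.
case=> p [k [p_prime _ k_gt0 ->]]; apply/eqP => /(congr1 Num.norm).
rewrite normrX normrN normr_nat normr1 => /eqP; rewrite -natrX pnatr_eq1.
by rewrite -expnM -(expn0 p) eqn_exp2l ?prime_gt1 // muln_eq0; lia.
Qed.

Lemma mqV_exp_neq1 (q l : nat) : odd_prime_power q -> (mq q)^-1 ^+ l.+1 != 1.
Proof.
by move=> hq; rewrite exprVn -invr1 (inj_eq invr_inj) mq_exp_neq1.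
Qed.

(** Isolates the dependence on k in the shape of [gbin_alternating_sum], with r = n - h and u = h -
    s. *)
Lemma MqE (q n h a b c k s : nat) : odd_prime_power q ->
  (a + b + c = n)%N -> (h <= a + b)%N -> (s <= b)%N -> (s < a + b)%N ->
  (k <= c)%N -> (k + s <= h)%N ->
  Mq q n h a b c (k + s) s =
  mq q ^+ (h * (a + b - h) + s * (a + b - s) + c * (h - s))
  * gbin (mq q)^-1 b s * qpoch (mq q) (a + b - s).-1
  * (gbin (mq q)^-1 c k * ((-1) ^+ k * (mq q)^-1 ^+ 'C(k, 2)
       * gbin (mq q)^-1 (n - h + (h - s) - k) (n - h))).
Proof.
move=> hq abc leh lesb ltsm lekc leksh.
have x_neq0 := mq_neq0 q hq.
have y_gen l := mqV_exp_neq1 q l hq.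
have nz j := qpoch_neq0 _ _ j y_gen.
rewrite /Mq /Cq (MexpE n h (a + b)) // !Pq_qpoch.
(* This selects the product branch of [Cq]. *)
have -> : (0 < a + (b - s))%N by lia.
have -> : \prod_(1 <= i < a + (b - s)) (1 - mq q ^+ i) =
          qpoch (mq q) (a + b - s).-1.
  by rewrite /qpoch; congr bigop; congr index_iota; lia.
under eq_bigr do rewrite -exprVn.
rewrite prod_qpoch //; last by lia.
have -> : h%:Z + 1 - s%:Z + 1 = (h - s).+2%:Z by lia.
rewrite -exprnP expfzDr // -invr_expz -!exprnP exprVn.
rewrite !gbinE //; [|lia..].
have -> : (n - h + (h - s) - k - (n - h) = h - (k + s))%N by lia.
have -> : (n - h + (h - s) - k = n - (k + s))%N by lia.
have -> : (c + s - (k + s) = c - k)%N by lia.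
rewrite addnK.
have -> : (-1) ^+ (k + s + h) = (-1) ^+ k * (-1) ^+ (h - s).+2 :> rat.
  rewrite -exprD -signr_odd -[RHS]signr_odd; congr (_ ^+ _); lia.
(* This sign occurs both in (-1)^(i+h) and in [Cq], so it cancels. *)
have sgn2 : (-1) ^+ (h - s).+2 * (-1) ^+ (h - s).+2 = 1 :> rat.
  by rewrite -exprMn mulrN1 opprK expr1n.
rewrite -[RHS]mulr1 -[X in _ = _ * X]sgn2.
by field; rewrite !nz !expf_neq0.
Qed.

Lemma sum_Mq (q n h a b c s : nat) : odd_prime_power q ->
  (a + b + c = n)%N -> (h <= a + b)%N -> (s <= h)%N -> (s <= b)%N ->
  (s < a + b)%N ->
  \sum_(s <= i < (minn (s + c) h).+1) Mq q n h a b c i s =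
  mq q ^+ (h * (a + b - h) + s * (a + b - s))
  * gbin (mq q)^-1 (a + b - s) (h - s) * gbin (mq q)^-1 b s
  * qpoch (mq q) (a + b - s).-1.
Proof.
move=> hq abc leh lesh lesb ltsm; have x_neq0 := mq_neq0 q hq.
rewrite -{1}[s]add0n big_addn.
have -> : ((minn (s + c) h).+1 - s = (minn c (h - s)).+1)%N by lia.
rewrite (eq_big_nat _ _ (F2 := fun k =>
    mq q ^+ (h * (a + b - h) + s * (a + b - s) + c * (h - s))
    * gbin (mq q)^-1 b s * qpoch (mq q) (a + b - s).-1
    * (gbin (mq q)^-1 c k * ((-1) ^+ k * (mq q)^-1 ^+ 'C(k, 2)
       * gbin (mq q)^-1 (n - h + (h - s) - k) (n - h))))); last first.
  by move=> k lek; apply: MqE => //; lia.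
rewrite -mulr_sumr [X in _ * X](_ : _ =
  (mq q)^-1 ^+ (c * (h - s)) * gbin (mq q)^-1 (a + b - s) (h - s)); last first.
  have -> : (a + b - s = n - h + (h - s) - c)%N by lia.
  rewrite -gbin_alternating_sum; last by lia.
  (* The identity runs up to k = c; the terms with k > h - s vanish because the upper index drops
     below n - h. *)
  rewrite [RHS](big_cat_nat (n := (minn c (h - s)).+1)) //=; last by lia.
  rewrite [X in _ + X]big_nat [X in _ + X]big1 ?addr0 // => k lek.
  by rewrite (gbin_small _ _ (_ - k)) ?mulr0 //; lia.
rewrite (exprD _ (_ + _)%N) exprVn.
by field; rewrite expf_neq0.
Qed.

(** * Evaluation of [Dq] for a = 0 and a = 1 *)

Lemma Dq0E (q n h b c : nat) : odd_prime_power q ->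
  (h < b)%N -> (b + c = n)%N ->
  Dq q n h 0 b c =
  (\prod_(h.+1 <= l < b.+1) (1 - mq q ^+ l)) / (1 - mq q ^+ (b - h)).
Proof.
move=> hq lthb bc; have x_neq0 := mq_neq0 q hq.
have x_gen l := mq_exp_neq1 q l hq; have y_gen l := mqV_exp_neq1 q l hq.
have nz j := qpoch_neq0 _ _ j x_gen.
rewrite /Dq (minn_idPl (ltnW lthb)).
rewrite (eq_big_nat _ _ (F2 := fun s => gbin (mq q) b h *
  (gbin (mq q) h s * (mq q ^+ (s * (b - h).-1.+1)
     * qpoch (mq q) ((b - h).-1 + h - s))))); last first.
  move=> s lesh; rewrite sum_Mq //; [|lia..].
  rewrite add0n -[_ * gbin _ _ _ * gbin _ _ _]mulrA gbin_mul_gbin //; [|lia..].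
  rewrite !(gbin_inv _ (mq q)) //; [|lia..].
  have -> : ((b - h).-1 + h - s = (b - s).-1)%N by lia.
  (* The power x^(s(h-s)) goes into the base change of [h, s]; the rest is the weight in
     [gbin_qpoch_sum]. *)
  have -> : (s * (b - s) = s * (h - s) + s * (b - h).-1.+1)%N.
    by rewrite -mulnDr; congr (_ * _)%N; lia.
  by rewrite !exprD; ring.
rewrite -mulr_sumr gbin_qpoch_sum prod_qpoch ?gbinE //; [|lia..].
have nz1 : 1 - mq q ^+ (b - h).-1.+1 != 0 by rewrite subr_eq0 eq_sym.
have -> : (b - h = (b - h).-1.+1)%N by lia.
by rewrite qpochS /=; field; rewrite !nz nz1.
Qed.

Lemma Dq1E (q n h b c : nat) : odd_prime_power q ->
  (h <= b.+1)%N -> (b + c + 1 = n)%N ->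
  Dq q n h 1 b c = \prod_(h.+1 <= l < b.+1) (1 - mq q ^+ l).
Proof.
move=> hq lehb bc; have x_neq0 := mq_neq0 q hq.
have x_gen l := mq_exp_neq1 q l hq; have y_gen l := mqV_exp_neq1 q l hq.
have nz j := qpoch_neq0 _ _ j x_gen.
have nz1 l : 1 - mq q ^+ l.+1 != 0 by rewrite subr_eq0 eq_sym.
have nz3 l : mq q ^+ l != 0 by rewrite expf_neq0.
pose f s := gbin (mq q) h s * (mq q ^+ (s * (b.+1 - h).+1)
     * qpoch (mq q) (b.+1 - h + h - s)).
have sumf : \sum_(0 <= s < h.+1) f s = qpoch (mq q) (b.+1 - h).
  exact: gbin_qpoch_sum.
rewrite /Dq (eq_big_nat _ _ (F2 := fun s =>
  gbin (mq q) b.+1 h / (1 - mq q ^+ b.+1) * f s)); last first.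
  move=> s lesh; rewrite sum_Mq //; [|lia..].
  (* The quotient (1 - y^(b+1-s)) / (1 - y^(b+1)) equals x^s (1 - x^(b+1-s)) / (1 - x^(b+1)): its
     numerator extends (x)_(b-s), and x^s raises e to b + 1 - h. *)
  rewrite add1n (gbin_predl _ _ b s) //; last by lia.
  rewrite !mulrA -[_ * gbin _ _ _ * gbin _ _ _]mulrA gbin_mul_gbin //; [|lia..].
  rewrite /f !(gbin_inv _ (mq q)) //; [|lia..].
  have -> : (b.+1 - h + h - s = (b - s).+1)%N by lia.
  have -> : (b.+1 - s = (b - s).+1)%N by lia.
  have -> : (s * (b - s).+1 = s * (h - s) + s * (b.+1 - h))%N.
    by rewrite -mulnDr; congr (_ * _)%N; lia.
  rewrite succnK qpochS mulnS !exprD !exprVn.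
  have := nz1 b.
  have -> : mq q ^+ b.+1 = mq q ^+ (b - s).+1 * mq q ^+ s.
    by rewrite -exprD; congr (_ ^+ _); lia.
  by move=> nzb; field; rewrite !nz3 nzb -opprB oppr_eq0.
rewrite -mulr_sumr; case: (leqP h b) => [leb|ltb].
  rewrite sumf prod_qpoch ?gbinE //.
  by rewrite qpochS; field; rewrite !nz !nz1.
(* The full sum is (x)_0 = 1 and the missing term s = h is x^h; the difference cancels the
   denominator 1 - x^(b+1). *)
have eqh : h = b.+1 by lia.
rewrite -eqh.
have -> : \sum_(0 <= s < h) f s = 1 - mq q ^+ h.
  apply/eqP; rewrite eq_sym subr_eq; apply/eqP.
  move: sumf; rewrite big_nat_recr //= /f -eqh gbinn subnn add0n subnn qpoch0.
  by rewrite muln1 mul1r mulr1 => ->.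
by rewrite gbinn big_geq ?eqh // mul1r mulVf.
Qed.

Theorem theorem9p8 (q n h b c : nat) (hq : odd_prime_power q) (hn : (h <= n)%N) :
  ((h + 1 <= b)%N -> (b <= n)%N -> (b + c)%N = n ->
     Dq q n h 0 b c =
       (\prod_(h.+1 <= l < b.+1) (1 - mq q ^+ l)) / (1 - mq q ^+ (b - h)))
  /\
  ((h <= b + 1)%N -> (b <= n)%N -> (b + c + 1)%N = n ->
     ((b + 1)%N = h \/ b = h -> Dq q n h 1 b c = 1)
     /\
     ((h + 1 <= b)%N ->
        Dq q n h 1 b c = \prod_(h.+1 <= l < b.+1) (1 - mq q ^+ l))).
Proof.
split=> [lthb _ bc|lehb _ bc]; first by apply: Dq0E => //; lia.
have D1 : Dq q n h 1 b c = \prod_(h.+1 <= l < b.+1) (1 - mq q ^+ l).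
  by apply: Dq1E => //; lia.
(* For b = h - 1 or b = h the product is empty. *)
split=> [hb|_]; rewrite D1 //.
by rewrite big_geq //; lia.
Qed.
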